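(* Let $A$ be a set, $F\subset A$ a subset, and $\mathcal S$ a non-empty collection of sequences in $A$ of length $<\omega_1$ with the following properties: (i) If $(a_{\alpha'})_{\alpha'<\alpha}\in\mathcal S$ is such that $a_{\alpha'}\notin F$ for every $\alpha'<\alpha$, then there is $a_\alpha\in A$ such that $(a_{\alpha'})_{\alpha'\leq\alpha}\in\mathcal S$. (ii) If $\alpha<\omega_1$ is a limit ordinal and $(a_{\alpha'})_{\alpha'<\alpha}$ is a sequence in $A$ such that $(a_{\alpha''})_{\alpha''<\alpha'}\in\mathcal S$ for every $\alpha'<\alpha$, then $(a_{\alpha'})_{\alpha'<\alpha}\in\mathcal S$. (iii) There is no sequence $(a_\alpha)_{\alpha<\omega_1}$ in $A$ such that for every $\alpha<\omega_1$ we have $(a_{\alpha'})_{\alpha'<\alpha}\in\mathcal S$. Then there are $(a_{\alpha'})_{\alpha'<\alpha}\in\mathcal S$ and $\bar\alpha<\alpha$ such that $a_{\bar\alpha}\in F$. In particular, $F$ is not empty.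
   Context: Greek letters denote ordinals, and $\omega_1$ is the first uncountable ordinal. A sequence in $A$ is a map from some ordinal $\alpha$ to $A$, written $(a_{\alpha'})_{\alpha'<\alpha}$; the ordinal $\alpha$ is its length. A sequence $(a_{\alpha'})_{\alpha'\leq\alpha}$ has length $\alpha+1$. A successor ordinal is one of the form $\beta+1$; a limit ordinal is an ordinal that is not a successor. With this convention $0$ is a limit ordinal (so (ii) applies also to $\alpha=0$). *)

(* Defs.v *)
From HB Require Import structures.
From mathcomp Require Import all_boot all_order.
From mathcomp Require Import boolp classical_sets functions cardinality wochoice.

Set Implicit Arguments.
Unset Strict Implicit.
Unset Printing Implicit Defensive.

Import Order.TTheory.
Local Open Scope classical_set_scope.
Local Open Scope order_scope.

(* The ordinal omega_1 is realized by the points of a well-ordering of the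
   power set of nat below which there are only countably many points.  Lemmas
   [omega1_wf], [omega1_uncountable] and [omega1_countable_below] show that
   this is a well-order of type omega_1; its points are the ordinals < omega_1,
   [a : omega1] being identified with the set of all [b : omega1], [b < a]. *)

Definition powernat_le : rel (set nat) :=
  sval (well_ordering_principle (set nat)).

Lemma powernat_le_wo : well_order powernat_le.
Proof. exact: (svalP (well_ordering_principle (set nat))). Qed.

Lemma powernat_le_min (P : set (set nat)) :
  P !=set0 -> exists2 m, P m & forall x, P x -> powernat_le m x.
Proof.
move=> [x Px]; have [|m [[/asboolP Pm min_m] _]] :=
    powernat_le_wo (A := fun x => `[< P x >]).
  by exists x; apply/asboolP.
by exists m => // y Py; apply: min_m; apply/asboolP.
Qed.

Lemma powernat_le_total : total powernat_le.
Proof.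
move=> x y; have [|m] := @powernat_le_min [set x; y]; first by exists x; left.
case=> -> m_le; first by rewrite m_le //; right.
by rewrite orbC m_le //; left.
Qed.

Lemma powernat_le_refl : reflexive powernat_le.
Proof. by move=> x; have /orP[] := powernat_le_total x x. Qed.

Lemma powernat_le_anti : antisymmetric powernat_le.
Proof.
move=> x y /andP[xy yx].
have [|m [_ min_u]] := powernat_le_wo (A := pred2 x y).
  by exists x; rewrite inE eqxx.
rewrite -(min_u x) ?(min_u y) //; split; rewrite ?inE ?eqxx ?orbT //.
  by move=> z; rewrite inE => /orP[] /eqP-> //; exact: powernat_le_refl.
by move=> z; rewrite inE => /orP[] /eqP-> //; exact: powernat_le_refl.
Qed.

Lemma powernat_le_trans : transitive powernat_le.
Proof.
move=> y x z xy yz.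
have [|m] := @powernat_le_min [set t | [\/ t = x, t = y | t = z]].
  by exists x; constructor 1.
case=> -> m_le; first by apply: m_le; apply: Or33.
  have yx : powernat_le y x by apply: m_le; apply: Or31.
  by rewrite (@powernat_le_anti x y) // xy yx.
have zy : powernat_le z y by apply: m_le; apply: Or32.
by rewrite (@powernat_le_anti z y) ?zy ?yz.
Qed.

Definition omega1 : Type :=
  {x : set nat | countable [set y | powernat_le y x]}.

HB.instance Definition _ := SubChoice.on omega1.

Definition omega1_le : rel omega1 := fun a b => powernat_le (val a) (val b).

Fact omega1_display : Order.disp_t. Proof. exact: Order.Disp tt tt. Qed.

Lemma omega1_le_refl : reflexive omega1_le.
Proof. by move=> a; exact: powernat_le_refl. Qed.
Lemma omega1_le_anti : antisymmetric omega1_le.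
Proof. by move=> a b ab; apply: val_inj; exact: powernat_le_anti. Qed.
Lemma omega1_le_trans : transitive omega1_le.
Proof. by move=> b a c; exact: powernat_le_trans. Qed.
Lemma omega1_le_total : total omega1_le.
Proof. by move=> a b; exact: powernat_le_total. Qed.

HB.instance Definition _ := Order.Le_isPOrder.Build omega1_display omega1
  omega1_le_refl omega1_le_anti omega1_le_trans.
HB.instance Definition _ :=
  Order.POrder_isTotal.Build omega1_display omega1 omega1_le_total.

Lemma omega1_min (P : set omega1) :
  P !=set0 -> exists2 m, P m & forall a, P a -> m <= a.
Proof.
move=> [a Pa]; have [|_ [m Pm <-] m_le] := @powernat_le_min (val @` P).
  by exists (val a); exists a.
by exists m => // b Pb; apply: m_le; exists b.
Qed.

Lemma omega1_wf : well_founded (fun a b : omega1 => a < b).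
Proof.
move=> a; apply: contrapT => nAa.
have [|m nAm m_le] := @omega1_min [set b | ~ Acc (fun a b => a < b) b].
  by exists a.
apply: nAm; constructor=> b bm; apply: contrapT => /m_le.
by rewrite leNgt bm.
Qed.

Lemma omega1_countable_below (a : omega1) : countable [set b : omega1 | b < a].
Proof.
have /countable_injP[f f_inj] := valP a.
apply/countable_injP; exists (f \o val) => b c.
rewrite !inE /= => /ltW ba /ltW ca fE; apply: val_inj.
by apply: f_inj => //; rewrite inE.
Qed.

Lemma omega1_uncountable : ~ countable [set: omega1].
Proof.
pose U : set (set nat) := [set x | countable [set y | powernat_le y x]].
move=> /countable_injP[f f_inj].
have cU : countable U.
  have UE : U `<=` val @` [set: omega1].
    by move=> x Ux; exists (exist _ x Ux : omega1).
  apply: (sub_countable (subset_card_le UE)).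
  apply: (sub_countable (card_image_le _ _)).
  by apply/countable_injP; exists f.
have [|m nUm m_le] := @powernat_le_min (~` U).
  apply: contrapT => /forallNP UT.
  have {}UT (x : set nat) : U x by apply: contrapT; exact: UT.
  have /countable_injP[g g_inj] := cU.
  pose D : set nat := [set n | exists2 X, g X = n & ~ X n].
  have DE : D (g D) <-> ~ D (g D).
    split=> [[X gX nX] DD|nD]; last by exists D.
    by apply: nX; rewrite (g_inj X D) ?inE.
  by have nD : ~ D (g D) by [move=> /[dup] /DE]; exact: nD (DE.2 nD).
apply: nUm; rewrite /U /=.
have sub : [set y | powernat_le y m] `<=` U `|` [set m].
  move=> y ym; have [->|nym] := pselect (y = m); [by right|left].
  apply: contrapT => /m_le my; apply: nym; apply: powernat_le_anti.
  by rewrite my andbT.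
apply: (sub_countable (subset_card_le sub)).
rewrite -bigcup2E; apply: bigcup_countable => // -[|[|i]] _ //=.
Qed.

Lemma omega1_no_max (a : omega1) : [set b : omega1 | a < b] !=set0.
Proof.
apply: contrapT => /forallNP amax; apply: omega1_uncountable.
have sub : [set: omega1] `<=` [set b | b < a] `|` [set a].
  move=> b _; have := amax b => /negP; rewrite -leNgt le_eqVlt.
  by case/orP=> [/eqP|]; [right|left].
apply: (sub_countable (subset_card_le sub)).
rewrite -bigcup2E; apply: bigcup_countable => // -[|[|i]] _ //=.
exact: omega1_countable_below.
Qed.

(* The successor a + 1, as the least element above a. *)
Definition osucc (a : omega1) : omega1 :=
  sval (cid2 (omega1_min (omega1_no_max a))).

Lemma lt_osucc (a : omega1) : a < osucc a.
Proof. by rewrite /osucc; case: cid2. Qed.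

Lemma osucc_le (a b : omega1) : (osucc a <= b) = (a < b).
Proof.
rewrite /osucc; case: cid2 => c /= ac c_le.
by apply/idP/idP; [exact: lt_le_trans|exact: c_le].
Qed.

Lemma lt_osuccE (a b : omega1) : (b < osucc a) = (b <= a).
Proof. by rewrite ltNge osucc_le -leNgt. Qed.

(* 0 is a limit with this convention. *)
Definition is_limit (a : omega1) : Prop := ~ exists b, a = osucc b.

Definition below (a : omega1) : Type := {b : omega1 | b < a}.

(* The sequences of length a in A; sequences of length omega_1 are functions
   omega1 -> A. *)
Definition oseq (A : Type) (a : omega1) : Type := below a -> A.

Definition oprefix (A : Type) (a b : omega1) (s : oseq A a) (ba : b < a) :
    oseq A b :=
  fun c => s (exist _ (val c) (lt_trans (valP c) ba)).

Definition oprefix1 (A : Type) (s : omega1 -> A) (a : omega1) : oseq A a :=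
  fun c => s (val c).
Arguments oprefix1 [A] s a _.

(* The extension of s, of length a + 1, whose value at a is x. *)
Definition orcons (A : Type) (a : omega1) (s : oseq A a) (x : A) :
    oseq A (osucc a) :=
  fun c => if insub (val c) : option (below a) is Some c' then s c' else x.

Lemma orcons_below (A : Type) (a : omega1) (s : oseq A a) (x : A) :
  oprefix (orcons s x) (lt_osucc a) = s.
Proof.
apply/funext => c; rewrite /oprefix /orcons /=; case: insubP => [c' _|].
  by move=> /val_inj ->.
by rewrite (valP c).
Qed.

Lemma orcons_last (A : Type) (a : omega1) (s : oseq A a) (x : A) :
  orcons s x (exist _ a (lt_osucc a)) = x.
Proof. by rewrite /orcons /= insubF // ltxx. Qed.

(* Main.v *)
Require Import Defs.
From mathcomp Require Import all_boot all_order.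
From mathcomp Require Import boolp classical_sets.

Import Order.TTheory.
Local Open Scope classical_set_scope.
Local Open Scope order_scope.

(** If no sequence of the family S met F, then condition (i) would extend every
    sequence of S, so a choice of extensions is a recursion rule: it turns a
    sequence of length a into a next value at a.  Following this rule along all
    of omega_1 ([omega1_recursion]) gives a sequence of length omega_1 whose
    initial segments are in S, by induction on their length: (i) handles
    successor lengths and (ii) limit lengths, 0 included
    ([omega1_sequence_of_extension]).  This is what (iii) forbids.  The family
    S need not be closed under initial segments, so the recursion has to start
    from the empty sequence.  Extending a member of S provides a point of A, the value
    of the rule on sequences outside S. *)

(** Transfinite recursion along omega_1: well-founded recursion in which the
    values already computed are presented as a sequence of length [a]. *)
Lemma omega1_recursion (A : Type) (next : forall a : omega1, oseq A a -> A) :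
  exists s : omega1 -> A, forall a, s a = next a (oprefix1 s a).
Proof.
pose step a (rec : forall b : omega1, b < a -> A) : A :=
  next a (fun c => rec (val c) (valP c)).
exists (Fix omega1_wf (fun=> A) step) => a.
rewrite Fix_eq // => b f g fg; congr next.
by apply/funext => c; exact: fg.
Qed.

Lemma orcons_oprefix1 (A : Type) (s : omega1 -> A) (a : omega1) :
  orcons (oprefix1 s a) (s a) = oprefix1 s (osucc a).
Proof.
apply/funext => c; rewrite /orcons /oprefix1; case: insubP => [c' _ -> //|].
(* c <= a and not c < a, so c is the last index a. *)
have := valP c; rewrite lt_osuccE le_eqVlt => /orP[/eqP -> //|ca].
by rewrite ca.
Qed.

(** The recursion never leaves [S], so the value prescribed by [next] always is
    an extension inside [S]. *)
Lemma omega1_sequence_of_extension (A : Type)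
    (S : forall a : omega1, set (oseq A a)) (next : forall a, oseq A a -> A) :
  (forall a s, S a s -> S (osucc a) (orcons s (next a s))) ->
  (forall (a : omega1) (s : oseq A a), is_limit a ->
     (forall (b : omega1) (ba : b < a), S b (oprefix s ba)) -> S a s) ->
  exists s : omega1 -> A, forall a, S a (oprefix1 s a).
Proof.
move=> S_next S_limit; have [s sE] := omega1_recursion A next.
exists s => a; elim/(well_founded_ind omega1_wf): a => a IHa.
have [[b ab]|a_limit] := pselect (exists b, a = osucc b).
  rewrite ab -orcons_oprefix1 sE; apply/S_next/IHa.
  by rewrite ab lt_osucc.
by apply: S_limit => // b ba; exact: IHa.
Qed.

Theorem lemma2p1 (A : Type) (F : set A) (S : forall a : omega1, set (oseq A a))
  (S_nonempty : exists a : omega1, S a !=set0)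
  (S_extend : forall (a : omega1) (s : oseq A a), S a s ->
     (forall b : below a, ~ F (s b)) -> exists x : A, S (osucc a) (orcons s x))
  (S_limit : forall (a : omega1) (s : oseq A a), is_limit a ->
     (forall (b : omega1) (ba : b < a), S b (oprefix s ba)) -> S a s)
  (S_omega1 : ~ exists s : omega1 -> A, forall a : omega1, S a (oprefix1 s a)) :
  (exists (a : omega1) (s : oseq A a), S a s /\ exists b : below a, F (s b)) /\
  F !=set0.
Proof.
suff [a [s [Sas [b Fsb]]]] :
    exists (a : omega1) (s : oseq A a), S a s /\ exists b : below a, F (s b).
  by split; [exists a, s; split=> //; exists b | exists (s b)].
apply: contrapT => S_avoids_F; apply: S_omega1.
have S_extends a s : S a s -> exists x, S (osucc a) (orcons s x).
  move=> Sas; apply: S_extend => // b Fsb; apply: S_avoids_F.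
  by exists a, s; split=> //; exists b.
have [a0 [s0 /S_extends[x0 _]]] := S_nonempty.
have next_exists a (s : oseq A a) :
    {x | S a s -> S (osucc a) (orcons s x)}.
  apply: cid; have [/S_extends[x Sx]|nSas] := pselect (S a s).
    by exists x.
  by exists x0.
apply: (omega1_sequence_of_extension _ _ (fun a s => sval (next_exists a s))).
  by move=> a s; exact: svalP (next_exists a s).
exact: S_limit.
Qed.
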